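(* Let $X$ and $Y$ be compact metric spaces and let $F:X\to 2^X$ and $G:Y\to 2^Y$ be upper semi-continuous. If $(X,F)$ and $(Y,G)$ are topologically conjugate, then $h(F)=h(G)$.
   Context: $\mathbb{N}=\{1,2,\ldots\}$. For a compact metric space $X$ with metric $d$, $2^X$ is the set of non-empty compact subsets of $X$. $F:X\to 2^X$ is upper semi-continuous if for every $x\in X$ and every open $V\subseteq X$ containing $F(x)$ there is an open $U\ni x$ with $F(t)\subseteq V$ for all $t\in U$. Conjugacy: $(X,F)$ and $(Y,G)$ are topologically conjugate if there exists a homeomorphism $\varphi:X\to Y$ such that $G\circ\varphi=\varphi\circ F$, i.e. $G(\varphi(x))=\varphi(F(x))=\{\varphi(y):y\in F(x)\}$ for all $x\in X$. Entropy: for $n\in\mathbb{N}$, $\mathrm{Orb}_n(X,F)$ is the set of $n$-orbits, i.e. finite sequences $(x_0,\ldots,x_{n-1})$ in $X$ with $x_{i+1}\in F(x_i)$ for $0\le i\le n-2$, with the metric $D(\mathbf{x},\mathbf{y})=\max_{0\le i\le n-1}d(x_i,y_i)$. A subset of a metric space is $\epsilon$-separated if any two of its distinct points are at distance $\ge\epsilon$. $s_{n,\epsilon}(F)$ is the largest cardinality of an $\epsilon$-separated subset of $(\mathrm{Orb}_n(X,F),D)$, and the topological entropy of $F$ is $h(F)=\lim_{\epsilon\to0}\limsup_{n\to\infty}\frac1n\log s_{n,\epsilon}(F)\in[0,\infty]$. The entropy $h(G)$ is defined in the same way. *)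

(* Defs.v *)
From mathcomp Require Import all_boot all_order all_algebra.
From mathcomp Require Import all_classical all_reals all_analysis.

Set Implicit Arguments.
Unset Strict Implicit.
Unset Printing Implicit Defensive.

Import Order.TTheory GRing.Theory Num.Theory.
Import numFieldNormedType.Exports.

Local Open Scope classical_set_scope.
Local Open Scope ring_scope.

(* 2^X; a set-valued map F : X -> 2^X is represented by F : X -> set X
   together with the hypothesis [forall x, hyperspace (F x)]. *)
Definition hyperspace (X : topologicalType) : set (set X) :=
  [set A | A !=set0 /\ compact A].

Definition upper_semicontinuous (X Y : topologicalType) (F : X -> set Y) :
    Prop :=
  forall (x : X) (V : set Y), open V -> F x `<=` V ->
    exists U : set X, [/\ open U, U x & forall t, U t -> F t `<=` V].

Definition homeomorphism (X Y : topologicalType) (phi : X -> Y) : Prop :=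
  continuous phi /\
  exists psi : Y -> X, [/\ cancel phi psi, cancel psi phi & continuous psi].

Definition conjugate (X Y : topologicalType) (F : X -> set X)
    (G : Y -> set Y) : Prop :=
  exists phi : X -> Y,
    homeomorphism phi /\ forall x : X, G (phi x) = phi @` F x.

Definition orbits (X : Type) (F : X -> set X) (n : nat) : set (n.-tuple X) :=
  [set x | forall i j : 'I_n, j = i.+1 :> nat -> F (tnth x i) (tnth x j)].
Arguments orbits {X} F n.

(* The default value 0 of the maximum is neutral because mdist is
   nonnegative. *)
Definition orbit_dist (R : realType) (X : metricType R) (n : nat)
    (x y : n.-tuple X) : R :=
  \big[Num.max/0]_(i < n) mdist (tnth x i) (tnth y i).

Definition separated_for (R : realType) (T : Type) (D : T -> T -> R)
    (eps : R) (A : set T) : Prop :=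
  forall x y : T, A x -> A y -> x <> y -> eps <= D x y.

(* The largest cardinality is taken as a supremum in \bar R over the finite
   separated sets: it is attained when these cardinalities are bounded, and is
   +oo otherwise. *)
Definition max_separated (R : realType) (X : metricType R)
    (F : X -> set X) (n : nat) (eps : R) : \bar R :=
  ereal_sup [set (k%:R)%:E | k in [set k : nat |
    exists A : set (n.-tuple X),
      [/\ A `<=` orbits F n, separated_for (@orbit_dist R X n) eps A
        & (A #= `I_k)%card]]].

(* lne 0 = -oo and lne +oo = +oo.  The term n = 0 does not affect the limsup,
   and eps tends to 0 through positive values. *)
Definition entropy (R : realType) (X : metricType R) (F : X -> set X) :
    \bar R :=
  lim (limn_esup (fun n : nat =>
    ((n%:R^-1)%:E * lne (max_separated F n eps))%E) @[eps --> (0 : R)^'+]).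

(* Main.v *)
Require Import Defs.
From mathcomp Require Import all_boot all_order all_algebra.
From mathcomp Require Import all_classical all_reals all_analysis.

(** Entropy depends on the metric only through the uniform structure.  On a
    compact space a conjugacy [phi : X -> Y] is uniformly continuous: for each
    [eps > 0] there is [delta > 0] such that points of [Y] at distance at least
    [eps] have preimages at distance at least [delta] ([heine_cantor]).  Hence
    [phi^-1], applied coordinatewise, sends an [eps]-separated set of
    [n]-orbits of [G] injectively onto a [delta]-separated set of [n]-orbits of
    [F], and the growth rate of [G] at scale [eps] is at most that of [F] at
    scale [delta] ([separation_rate_le]).

    Growth rates only increase as the scale shrinks, so the limit defining the
    entropy exists and is the supremum of the rates over all positive scales
    ([entropy_sup]).  Comparing suprema gives [h(G) <= h(F)]
    ([entropy_le_expanding]), and exchanging the roles of [phi] and its inverse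
    gives equality.  The conjugacy equation
    serves to carry orbits to orbits in each direction. *)

Set Implicit Arguments.
Unset Strict Implicit.
Unset Printing Implicit Defensive.

Import Order.TTheory GRing.Theory Num.Theory.
Import numFieldNormedType.Exports.

Local Open Scope classical_set_scope.
Local Open Scope ring_scope.

Lemma limn_esup_le (R : realType) (u v : nat -> \bar R) :
  (forall n, (u n <= v n)%E) -> (limn_esup u <= limn_esup v)%E.
Proof.
move=> uv; apply: le_ereal_inf_tmp => _ [V FV <-].
apply: ge_ereal_inf; exists (ereal_sup (u @` V)); first by exists V.
apply: ge_ereal_sup => _ [n Vn <-].
by apply: le_ereal_sup_tmp; exists (v n); [exists n|exact: uv].
Qed.

(** Halving the tolerance at each point [x] controls all pairs near [x]; the
    filter formulation of compactness makes the radius uniform in [x]. *)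
Lemma heine_cantor (R : realType) (X Y : metricType R) (f : X -> Y) :
  compact [set: X] -> continuous f -> unif_continuous f.
Proof.
move=> /compact_near_coveringP cptX cf; apply/unif_continuousP => e e0.
have e20 : 0 < e / 2 by rewrite divr_gt0.
have : \forall d \near (0 : R)^'+,
    [set: X] `<=` [set x | forall y, ball x d y -> ball (f x) e (f y)].
  apply: cptX => x _.
  have /nbhs_ballP[r /= r0 xr] : \forall y \near x, ball (f x) (e / 2) (f y).
    by apply: cf; exact: nbhsx_ballx.
  have r20 : 0 < r / 2 by rewrite divr_gt0.
  exists (ball x (r / 2), [set d | d < r / 2]) => /=.
    by split; [exact: nbhsx_ballx|exact: nbhs_right_lt].
  move=> [x' d] /= [xx' dr] y x'y; apply: (@ball_splitr _ _ (f x)).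
    apply: xr; apply: le_ball xx'.
    by rewrite ler_pdivrMr// ler_peMr ?ler1n// ltW.
  apply: xr; rewrite [r]splitr; apply: ball_triangle xx' _.
  by apply: le_ball x'y; exact: ltW.
move=> near_d; have [d [dP d0]] : exists d : R,
    ([set: X] `<=` [set x | forall y, ball x d y -> ball (f x) e (f y)]) /\
    0 < d.
  apply: (@filter_ex _ ((0 : R)^'+)); apply: filterI => //.
  exact: nbhs_right_gt.
by exists d => // -[x y] /= /(dP x I).
Qed.

Section orbits_along_map.
Context (R : realType) (X Y : metricType R).
Variables (F : X -> set X) (G : Y -> set Y) (psi : Y -> X).
Hypothesis psiGF : forall y z, G y z -> F (psi y) (psi z).

Lemma orbits_map n (y : n.-tuple Y) :
  orbits G n y -> orbits F n (map_tuple psi y).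
Proof. by move=> Gy i j ij; rewrite !tnth_map; exact/psiGF/Gy. Qed.

Variables (eps delta : R).
Hypotheses (eps_gt0 : 0 < eps) (delta_gt0 : 0 < delta).
Hypothesis psi_expand :
  forall y z, eps <= mdist y z -> delta <= mdist (psi y) (psi z).

Lemma orbit_dist_map n (y z : n.-tuple Y) : eps <= orbit_dist y z ->
  delta <= orbit_dist (map_tuple psi y) (map_tuple psi z).
Proof.
rewrite !leNgt; apply: contra => /bigmax_ltP[_ lt_delta].
apply: bigmax_lt => // i _.
rewrite ltNge; apply/negP => /psi_expand.
by have := lt_delta i isT; rewrite !tnth_map leNgt => ->.
Qed.

(** The image of a separated set under [psi] has the same cardinality because
    [delta] is positive: tuples with equal images are at distance less than
    [eps]. *)
Lemma max_separated_le n : (max_separated G n eps <= max_separated F n delta)%E.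
Proof.
apply: ereal_sup_le => _ [k [A [AG sepA cardA]] <-].
exists k => //; exists (map_tuple psi @` A); split.
- by move=> _ [y Ay <-]; exact/orbits_map/AG.
- move=> _ _ [y Ay <-] [z Az <-] yz.
  by apply/orbit_dist_map/sepA => // yzE; apply: yz; rewrite yzE.
- apply: card_eq_trans cardA; apply: inj_card_eq => y z /set_mem Ay /set_mem Az yz.
  apply: contrapT => /(sepA _ _ Ay Az)/orbit_dist_map.
  rewrite yz leNgt => /negP; apply; apply: bigmax_lt => // i _.
  by rewrite mdistxx.
Qed.

End orbits_along_map.

Lemma max_separated_ge0 (R : realType) (X : metricType R) (F : X -> set X) n
    (eps : R) : (0 <= max_separated F n eps)%E.
Proof.
apply: ereal_sup_ubound; exists 0%N => //; exists set0; split => //.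
by rewrite II0 card_eq00.
Qed.

Definition separation_rate (R : realType) (X : metricType R) (F : X -> set X)
    (eps : R) : \bar R :=
  limn_esup (fun n : nat =>
    ((n%:R^-1)%:E * lne (max_separated F n eps))%E).

Lemma separation_rate_le (R : realType) (X Y : metricType R)
    (F : X -> set X) (G : Y -> set Y) (psi : Y -> X) (eps delta : R) :
  (forall y z, G y z -> F (psi y) (psi z)) -> 0 < eps -> 0 < delta ->
  (forall y z, eps <= mdist y z -> delta <= mdist (psi y) (psi z)) ->
  (separation_rate G eps <= separation_rate F delta)%E.
Proof.
move=> psiGF eps0 delta0 psiE; apply: limn_esup_le => n.
apply: lee_wpmul2l; first by rewrite lee_fin invr_ge0.
rewrite lee_lne ?in_itv/= ?max_separated_ge0 ?leey//.
exact: (max_separated_le psiGF).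
Qed.

Lemma entropy_sup (R : realType) (X : metricType R) (F : X -> set X) :
  entropy F = ereal_sup (separation_rate F @` [set` `]0, +oo[]).
Proof.
apply: cvg_lim => //; apply: nonincreasing_at_right_cvge => //.
move=> e1 e2; rewrite !in_itv/= !andbT => e10 e20 e12.
(* Monotonicity in the scale: the identity expands scale e2 to scale e1. *)
by apply: (@separation_rate_le _ _ _ F F idfun) => // y z; exact: le_trans.
Qed.

(** The second hypothesis is the uniform continuity of the inverse of [psi], in
    contrapositive form.  As [delta] depends on [eps], the rates of [G] and [F]
    are not compared at equal scales; only their suprema are. *)
Lemma entropy_le_expanding (R : realType) (X Y : metricType R)
    (F : X -> set X) (G : Y -> set Y) (psi : Y -> X) :
  (forall y z, G y z -> F (psi y) (psi z)) ->
  (forall eps : R, 0 < eps -> exists2 delta, 0 < delta &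
    forall y z, eps <= mdist y z -> delta <= mdist (psi y) (psi z)) ->
  (entropy G <= entropy F)%E.
Proof.
move=> psiGF psiE; rewrite !entropy_sup; apply: ge_ereal_sup => _ [eps + <-].
rewrite /= in_itv/= andbT => eps0; have [delta delta0 dP] := psiE eps eps0.
apply: le_ereal_sup_tmp; exists (separation_rate F delta).
  by exists delta => //=; rewrite in_itv/= delta0.
exact: (separation_rate_le psiGF).
Qed.

Lemma continuous_cancel_expanding (R : realType) (X Y : metricType R)
    (phi : X -> Y) (psi : Y -> X) :
  compact [set: X] -> continuous phi -> cancel psi phi ->
  forall eps : R, 0 < eps -> exists2 delta, 0 < delta &
    forall y z, eps <= mdist y z -> delta <= mdist (psi y) (psi z).
Proof.
move=> cptX cphi psiK eps eps0.
have /unif_continuousP/(_ _ eps0)[delta delta0 dP] := heine_cantor cptX cphi.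
exists delta => // y z; rewrite !leNgt; apply: contra => yz.
have := dP (psi y, psi z); rewrite /= !psiK !ballEmdist; exact.
Qed.

Theorem theorem4p3 (R : realType) (X Y : metricType R)
  (F : X -> set X) (G : Y -> set Y)
  (cptX : compact [set: X]) (cptY : compact [set: Y])
  (F2X : forall x : X, hyperspace (F x))
  (G2Y : forall y : Y, hyperspace (G y))
  (Fusc : upper_semicontinuous F) (Gusc : upper_semicontinuous G)
  (FG : conjugate F G) :
  entropy F = entropy G.
Proof.
have [phi [[cphi [psi [phiK psiK cpsi]]] GphiE]] := FG.
apply/eqP; rewrite eq_le; apply/andP; split.
- apply: (@entropy_le_expanding _ _ _ G F phi).
    by move=> x x' Fxx'; rewrite GphiE; exists x'.
  exact: continuous_cancel_expanding cptY cpsi phiK.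
- apply: (@entropy_le_expanding _ _ _ F G psi).
    by move=> y z; rewrite -{1}(psiK y) GphiE => -[x Fx <-]; rewrite phiK.
  exact: continuous_cancel_expanding cptX cphi psiK.
Qed.
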